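(* Let $(X,\delta)$ be a weak metric space and let $T\colon X\to X$ be a firm non-expansive mapping. Then, for every $x\in X$ and every integer $k\geq 1$, the limits below exist and $$\inf_{w\in X}\delta(w,Tw)=\lim_{n\to\infty}\frac{\delta(x,T^{n}x)}{n}=\lim_{n\to\infty}\delta(T^{n}x,T^{n+1}x)=\frac{1}{k}\lim_{n\to\infty}\delta(T^{n}x,T^{n+k}x).$$
   Context: A weak metric on a set $X$ is a mapping $\delta\colon X\times X\to[0,+\infty[$ such that $\delta(x,x)=0$ for every $x\in X$ and $\delta(x,z)\leq\delta(x,y)+\delta(y,z)$ for every $x,y,z\in X$ (no symmetry is required, and $\delta(x,y)=0$ need not imply $x=y$). A mapping $T\colon X\to X$ is non-expansive if $\delta(Tx,Ty)\leq\delta(x,y)$ for every $x,y\in X$. A mapping $T\colon X\to X$ is firm if there exist mappings $q,r,s,t\colon X\times X\to[0,+\infty[$ such that (A) $\inf_{(x,y)\in X\times X}t(x,y)>0$; (B) $\sup_{(x,y)\in X\times X}\big(q(x,y)+r(x,y)+s(x,y)+2t(x,y)\big)\leq 1$; (C) for every $x,y\in X$, $$\delta(Tx,Ty)\leq q(x,y)\,\delta(x,y)+r(x,y)\,\delta(x,Tx)+s(x,y)\,\delta(y,Ty)+t(x,y)\big[\delta(x,Ty)+\delta(Tx,y)\big].$$ $T$ is firm non-expansive if it is both firm and non-expansive. $T^n$ denotes the $n$-th iterate of $T$. *)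

(* Defs.v *)
From mathcomp Require Import all_boot all_order all_algebra.
From mathcomp Require Import all_classical all_reals all_analysis.
Set Implicit Arguments.
Unset Strict Implicit.
Unset Printing Implicit Defensive.
Import Order.TTheory GRing.Theory Num.Theory numFieldNormedType.Exports.
Local Open Scope classical_set_scope.
Local Open Scope ring_scope.

Definition weak_metric (R : realType) (X : Type) (delta : X -> X -> R) : Prop :=
  [/\ forall x y, 0 <= delta x y,
      forall x, delta x x = 0
    & forall x y z, delta x z <= delta x y + delta y z].

Definition nonexpansive (R : realType) (X : Type) (delta : X -> X -> R)
    (T : X -> X) : Prop :=
  forall x y, delta (T x) (T y) <= delta x y.

(* The infimum and supremum are taken in the extended reals, because the real
   [sup] of an unbounded set is 0, which would make the second condition
   satisfied by unbounded coefficients. *)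
Definition firm (R : realType) (X : Type) (delta : X -> X -> R)
    (T : X -> X) : Prop :=
  exists q r s t : X * X -> R,
    [/\ forall p, [/\ 0 <= q p, 0 <= r p, 0 <= s p & 0 <= t p],
        (0 < ereal_inf (range (fun p => (t p)%:E)))%E,
        (ereal_sup (range (fun p => (q p + r p + s p + 2 * t p)%:E)) <= 1)%E
      & forall x y,
          delta (T x) (T y) <=
            q (x, y) * delta x y + r (x, y) * delta x (T x)
            + s (x, y) * delta y (T y)
            + t (x, y) * (delta x (T y) + delta (T x) y)].

Definition firm_nonexpansive (R : realType) (X : Type) (delta : X -> X -> R)
    (T : X -> X) : Prop :=
  firm delta T /\ nonexpansive delta T.

(* Main.v *)
Require Import Defs.
From mathcomp Require Import all_boot all_order all_algebra.
From mathcomp Require Import all_classical all_reals all_analysis.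
From mathcomp Require Import ring lra.
Set Implicit Arguments.
Unset Strict Implicit.
Unset Printing Implicit Defensive.
Import Order.TTheory GRing.Theory Num.Theory numFieldNormedType.Exports.
Local Open Scope classical_set_scope.
Local Open Scope ring_scope.

(** For fixed [j], the displacement [delta (T^n x) (T^(n+j) x)] decreases with
    [n] because [T] is non-expansive; let [L j] be its limit. The triangle
    inequality gives [L j <= j * L 1], and firmness forces equality.
    Indeed, if [L m = m * L 1] and [L (m+1) = (m+1) * L 1], then firmness at
    the pair [(T^n x, T^(n+m+1) x)] bounds [(m+1) * L 1] in the limit by
    [q * (m+1) * L 1 + (r + s) * L 1 + t * (L (m+2) + m * L 1)]. Since
    [q + r + s + 2 t <= 1] and [L 1 <= (m+1) * L 1], this leaves no room for
    [L (m+2) < (m+2) * L 1], as long as [t] stays away from 0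
    ([next_value_ge], [lim_displacement]).

    Linearity of [L] squeezes the escape rate: [n * L 1 = L n] is at most
    [delta x (T^n x)] because the displacement decreases to its limit, while
    [delta x (T^n x)] is at most the sum of the first [n] one-step
    displacements, whose mean tends to [L 1] by Cesaro's lemma
    ([cvg_escape_rate]).

    Finally the growth of [delta x (T^n x)] differs from that of
    [delta w (T^n w)] by a bounded amount, and the latter is at most
    [n * delta w (T w)]; dividing by [n], [L 1] is a lower bound of all
    [delta w (T w)] ([lim_displacement_le]). As [L 1] is the limit of such
    values along the orbit of [x], it is their infimum. *)

Definition displacement (R : realType) (X : Type) (delta : X -> X -> R)
    (T : X -> X) (x : X) (j n : nat) : R :=
  delta (iter n T x) (iter (n + j) T x).

Definition lim_disp (R : realType) (X : Type) (delta : X -> X -> R)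
    (T : X -> X) (x : X) (j : nat) : R :=
  inf (range (displacement delta T x j)).

(** The coefficient functions enter the proof only through their values at one
    pair at a time, so it suffices to keep a bound below [t] that does not
    depend on the pair. *)
Lemma firm_pointwise (R : realType) (X : Type) (delta : X -> X -> R)
    (T : X -> X) (x0 : X) : firm delta T ->
  exists2 t0 : R, 0 < t0 & forall x y, exists q r s t : R,
    [/\ [/\ 0 <= q, 0 <= r & 0 <= s], t0 <= t, q + r + s + 2 * t <= 1
      & delta (T x) (T y) <= q * delta x y + r * delta x (T x)
          + s * delta y (T y) + t * (delta x (T y) + delta (T x) y)].
Proof.
move=> [q [r [s [t [ge0 tinf qsup ineq]]]]].
have le_t p : (ereal_inf (range (fun p => (t p)%:E)) <= (t p)%:E)%E.
  by apply: ereal_inf_lbound; exists p.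
move: tinf le_t; case: (ereal_inf _) => [t0| |] // t0_gt0 le_t; last first.
  (* a nonempty set of reals does not have infimum [+oo] *)
  by have := le_t (x0, x0).
exists t0 => // x y; have [q0 r0 s0 _] := ge0 (x, y).
exists (q (x, y)), (r (x, y)), (s (x, y)), (t (x, y)); split => //.
- by have := le_t (x, y); rewrite lee_fin.
- rewrite -lee_fin; apply: le_trans qsup.
  by apply: ereal_sup_ubound; exists (x, y).
Qed.

Section Orbit.
Context {R : realType} {X : Type} {delta : X -> X -> R} {T : X -> X}.
Hypotheses (wm : weak_metric delta) (neT : nonexpansive delta T).

Let delta_ge0 x y : 0 <= delta x y. Proof. by case: wm. Qed.
Let deltaxx x : delta x x = 0. Proof. by case: wm. Qed.
Let delta_triangle x y z : delta x z <= delta x y + delta y z.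
Proof. by case: wm. Qed.

Local Notation disp := (displacement delta T).
Local Notation L := (lim_disp delta T).

Lemma displacement_ge0 x j n : 0 <= disp x j n.
Proof. exact: delta_ge0. Qed.

Lemma displacement_nonincreasing x j : nonincreasing_seq (disp x j).
Proof. by apply/nonincreasing_seqP => n; rewrite /displacement addSn !iterS; exact: neT. Qed.

Lemma displacement_lbound x j : has_lbound (range (disp x j)).
Proof. by exists 0 => _ [n _ <-]; exact: displacement_ge0. Qed.

Lemma cvg_displacement x j : disp x j @ \oo --> L x j.
Proof.
apply: nonincreasing_cvgn; first exact: displacement_nonincreasing.
exact: displacement_lbound.
Qed.

Lemma lim_disp_le x j n : L x j <= disp x j n.
Proof. by apply: ge_inf; [exact: displacement_lbound | exists n]. Qed.

Lemma lim_disp_ge0 x j : 0 <= L x j.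
Proof.
apply: lb_le_inf; first by exists (disp x j 0%N); exists 0%N.
by move=> _ [n _ <-]; exact: displacement_ge0.
Qed.

Lemma lim_disp0 x : L x 0%N = 0.
Proof.
apply/eqP; rewrite eq_le lim_disp_ge0 andbT.
by apply: le_trans (lim_disp_le x 0%N 0%N) _; rewrite /displacement deltaxx.
Qed.

Lemma displacement_triangle x i j n :
  disp x (i + j) n <= disp x i n + disp x j (n + i).
Proof. by rewrite /displacement addnA; exact: delta_triangle. Qed.

Lemma lim_disp_subadditive x i j : L x (i + j) <= L x i + L x j.
Proof.
have ci := @cvg_displacement x i.
have cj : (fun n => disp x j (n + i)%N) @ \oo --> L x j.
  by rewrite (cvg_shiftn i (disp x j)); exact: cvg_displacement.
have cij := @cvg_displacement x (i + j).
apply: (ler_cvg_to cij (cvgD ci cj)).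
by apply: nearW => n; exact: displacement_triangle.
Qed.

Lemma displacement_le_sum x n :
  delta x (iter n T x) <= series (disp x 1) n.
Proof.
elim: n => [|n IHn]; first by rewrite /series /= big_geq // deltaxx.
rewrite /series /= big_nat_recr //=.
apply: le_trans (delta_triangle _ (iter n T x) _) _.
by apply: lerD => //; rewrite /displacement addn1.
Qed.

(** The firmness inequality in the limit: the coefficients vary with [n] and
    need not converge, so the limit is replaced by estimates up to a small
    [e], whose total contribution is at most [e] since
    [q + r + s + 2 t <= 1]. *)
Lemma next_value_ge x m : firm delta T ->
  L x m = m%:R * L x 1 -> L x m.+1 = m.+1%:R * L x 1 ->
  m.+2%:R * L x 1 <= L x m.+2.
Proof.
move=> fT Lm Lm1; have [t0 t0_gt0 coef] := firm_pointwise x fT.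
rewrite leNgt; apply/negP => gap.
set D := m.+2%:R * L x 1 - L x m.+2.
have D_gt0 : 0 < D by rewrite subr_gt0.
(* the estimates below add up to [t * D <= e], which this [e] contradicts *)
pose e := t0 * D / 2.
have e_gt0 : 0 < e by rewrite /e; apply: divr_gt0 => //; exact: mulr_gt0.
have near_lim j : \forall n \near \oo, disp x j n <= L x j + e.
  by apply: cvgr_le; [exact: cvg_displacement | rewrite ltrDl].
near \oo => n.
have hm1 : disp x m.+1 n <= m.+1%:R * L x 1 + e.
  by rewrite -Lm1; near: n; exact: near_lim.
have hm2 : disp x m.+2 n <= L x m.+2 + e by near: n; exact: near_lim.
have h1 : disp x 1 n <= L x 1 + e by near: n; exact: near_lim.
have h1' : disp x 1 (n + m.+1) <= L x 1 + e.
  by apply: le_trans h1; apply: displacement_nonincreasing; exact: leq_addr.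
(* [delta (T x_n) x_(n+m+1)]: the shorter displacement, started one step later *)
have hm : disp x m n.+1 <= m%:R * L x 1 + e.
  rewrite -Lm; apply: (@le_trans _ _ (disp x m n)).
    exact: displacement_nonincreasing.
  by near: n; exact: near_lim.
have [q [r [s [t [[q0 r0 s0] t0t sum1 ineq]]]]] :=
  coef (iter n T x) (iter (n + m.+1) T x).
have main : m.+1%:R * L x 1 <= q * disp x m.+1 n + r * disp x 1 n
    + s * disp x 1 (n + m.+1) + t * (disp x m.+2 n + disp x m n.+1).
  rewrite -Lm1; apply: le_trans (lim_disp_le x m.+1 n.+1) _.
  by move: ineq; rewrite /displacement !addn1 !addSn !addnS !iterS.
have t_ge0 : 0 <= t by apply: le_trans t0t; exact: ltW.
have := ler_wpM2l q0 hm1; have := ler_wpM2l r0 h1.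
have := ler_wpM2l s0 h1'; have := ler_wpM2l t_ge0 hm2.
have := ler_wpM2l t_ge0 hm => b1 b2 b3 b4 b5.
have tD : t0 * D <= t * D by rewrite ler_pM2r.
have m0 : 0 <= m%:R :> R by [].
(* the slack in the coefficient bound, and the slack in [L 1 <= (m+1) * L 1] *)
have rest : 0 <= (1 - (q + r + s + 2 * t)) * (m.+1%:R * L x 1 + e).
  apply: mulr_ge0; first by rewrite subr_ge0.
  by apply: addr_ge0; [apply: mulr_ge0 => //; exact: lim_disp_ge0 | exact: ltW].
have rsm : 0 <= (r + s) * (m%:R * L x 1).
  apply: mulr_ge0; first exact: addr_ge0.
  by apply: mulr_ge0 => //; exact: lim_disp_ge0.
have e2 : t0 * D = 2 * e by rewrite /e; field.
have tDe : t * D <= e.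
  rewrite /D; move: m0 rest rsm main b1 b2 b3 b4 b5.
  rewrite -!(@natr1 _ m.+1) -!(@natr1 _ m).
  lra.
lra.
Unshelve. all: by end_near.
Qed.

Lemma lim_displacement x j : firm delta T -> L x j = j%:R * L x 1.
Proof.
move=> fT.
suff [] : L x j = j%:R * L x 1 /\ L x j.+1 = j.+1%:R * L x 1 by [].
elim: j => [|m [Lm Lm1]]; first by rewrite lim_disp0 mul0r mul1r.
split=> //; apply/eqP; rewrite eq_le next_value_ge // andbT.
have := lim_disp_subadditive x m.+1 1; rewrite addn1 Lm1.
by rewrite -(@natr1 _ m.+1) mulrDl mul1r.
Qed.

Lemma le_escape x n : firm delta T -> n%:R * L x 1 <= delta x (iter n T x).
Proof. by move=> fT; rewrite -lim_displacement //; exact: (lim_disp_le x n 0%N). Qed.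

Lemma cvg_escape_rate x : firm delta T ->
  (fun n => delta x (iter n T x) / n%:R) @ \oo --> L x 1.
Proof.
move=> fT; rewrite -cvg_shiftS /=.
apply: (squeeze_cvgr _ (cvg_cst (L x 1)) (cesaro (@cvg_displacement x 1))).
apply: nearW => n; apply/andP; split.
  by rewrite ler_pdivlMr // mulrC; exact: le_escape.
rewrite mulrC /arithmetic_mean /= ler_pM2l ?invr_gt0 //.
exact: (displacement_le_sum x n.+1).
Qed.

Lemma iter_nonexpansive n : nonexpansive delta (iter n T).
Proof.
elim: n => [|n IHn] y z //=.
exact: le_trans (neT _ _) (IHn _ _).
Qed.

Lemma escape_le_mul w n : delta w (iter n T w) <= n%:R * delta w (T w).
Proof.
apply: le_trans (displacement_le_sum w n) _.
rewrite /series /= mulr_natl -[X in _ *+ X](subn0 n) -sumr_const_nat.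
apply: ler_sum => i _.
exact: (@displacement_nonincreasing w 1 0%N i (leq0n i)).
Qed.

(** Going from [x] to [T^n x] through [w] and [T^n w] costs a detour bounded
    independently of [n], so the orbit of [x] escapes no faster than that of
    [w]. *)
Lemma lim_displacement_le x w : firm delta T -> L x 1 <= delta w (T w).
Proof.
move=> fT; pose C := delta x w + delta w x.
have bound n : L x 1 - delta w (T w) <= C * harmonic n.
  rewrite /harmonic /= ler_pdivlMr // mulrC mulrBr lerBlDr.
  apply: le_trans (le_escape x n.+1 fT) _.
  apply: le_trans (delta_triangle _ w _) _.
  rewrite /C -addrA lerD2l addrC.
  apply: le_trans (delta_triangle _ (iter n.+1 T w) _) _.
  by apply: lerD; [exact: escape_le_mul | exact: iter_nonexpansive].
rewrite -subr_le0 -(mulr0 C).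
have lim0 : (fun n => C * harmonic n) @ \oo --> C * 0.
  by apply: cvgM; [exact: cvg_cst | exact: cvg_harmonic].
apply: (cvgr_to_ge lim0).
by apply: nearW => n; exact: bound.
Qed.

Lemma inf_displacement x : firm delta T ->
  inf (range (fun w => delta w (T w))) = L x 1.
Proof.
move=> fT; apply/eqP; rewrite eq_le; apply/andP; split; last first.
  apply: lb_le_inf; first by exists (delta x (T x)); exists x.
  by move=> _ [w _ <-]; exact: lim_displacement_le.
apply: lb_le_inf; first by exists (disp x 1 0%N); exists 0%N.
move=> _ [n _ <-]; apply: ge_inf; last by exists (iter n T x) => //; rewrite /displacement addn1.
by exists 0 => _ [w _ <-].
Qed.

End Orbit.

Theorem theorem1p1 (R : realType) (X : Type) (delta : X -> X -> R)
    (T : X -> X) (hdelta : weak_metric delta) (hT : firm_nonexpansive delta T)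
    (x : X) (k : nat) (hk : (1 <= k)%N) :
  let a := (fun n : nat => delta x (iter n T x) / n%:R) : nat -> R in
  let b := (fun n : nat => delta (iter n T x) (iter n.+1 T x)) : nat -> R in
  let c := (fun n : nat => delta (iter n T x) (iter (n + k)%N T x)) : nat -> R in
  [/\ cvgn a, cvgn b & cvgn c] /\
  [/\ inf (range (fun w : X => delta w (T w))) = limn a,
      limn a = limn b
    & limn b = k%:R^-1 * limn c].
Proof.
move=> a b c; have [fT neT] := hT.
have ca : a @ \oo --> lim_disp delta T x 1 by exact: cvg_escape_rate.
have cb : b @ \oo --> lim_disp delta T x 1.
  have -> : b = displacement delta T x 1.
    by apply: funext => n; rewrite /displacement addn1.
  exact: cvg_displacement.
have cc : c @ \oo --> lim_disp delta T x k by exact: cvg_displacement.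
split; first by split; [exact: (cvgP _ ca) | exact: (cvgP _ cb) | exact: (cvgP _ cc)].
have -> : limn a = lim_disp delta T x 1 by exact/cvg_lim.
have -> : limn b = lim_disp delta T x 1 by exact/cvg_lim.
have -> : limn c = lim_disp delta T x k by exact/cvg_lim.
split => //; first exact: inf_displacement.
by rewrite [in RHS]lim_displacement // mulKf // pnatr_eq0 -lt0n.
Qed.
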